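(* Let $M$ be a compact Riemannian manifold, $E$ a vector bundle over $M$, $p\ge2$, and $\nabla$ a connection in $\mathcal W^p(E)$. Then $$\frac1p\Big(\frac2{\mathrm{Volume}(M)}\int_M\frac{\|R^\nabla\|^2}{2}\,dv\Big)^{\frac p2}\le\frac1{\mathrm{Volume}(M)}\int_M\frac{\|R^\nabla\|^p}{p}\,dv,$$ that is, $$\frac1p\Big(\frac2{\mathrm{Volume}(M)}\mathcal{YM}(\nabla)\Big)^{\frac p2}\le\frac1{\mathrm{Volume}(M)}\mathcal{YM}_p(\nabla).$$ Equality holds if and only if $\|R^\nabla\|$ is constant almost everywhere.
   Context: $E$ is equipped with a fiber metric. For a connection $\nabla$ on $E$, $R^\nabla$ is its curvature and, at $x\in M$, $\|R^\nabla\|^2=\sum_{i<j}\|R^\nabla_{e_i,e_j}\|^2$ for an orthonormal basis $\{e_i\}$ of $T_xM$, with the norm on $\mathrm{Hom}(E,E)$ given by $\langle S,U\rangle=\mathrm{trace}(S^T\circ U)$. The Yang-Mills functional is $\mathcal{YM}(\nabla)=\int_M\frac12\|R^\nabla\|^2dv$ and the $p$-Yang-Mills functional is $\mathcal{YM}_p(\nabla)=\int_M\frac1p\|R^\nabla\|^pdv$. $\mathcal L_1^p(E)$ denotes the Sobolev space of connections of $E$ which are $p$-integrable together with their first derivatives, and $\mathcal W^p(E)=\mathcal L_1^p(E)\cap\mathcal L_1^2(E)$ for $p\ge2$.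
   Formalization: ''Equality only if the curvature norm is constant a.e.'' is stated only for p > 2 and finite p-Yang-Mills energy: at p = 2 both sides always coincide, and both sides can be infinite for a nonconstant norm. *)

(* Defs.v *)
(* Conventions: tangent vectors in coordinates are row
   vectors, elements of the fibres of a bundle in a trivialization are column
   vectors; a subset of 'rV[R]_n is integrated over by enumerating its
   coordinates as an n-tuple, tuples being the type that carries the Borel
   (= product) sigma-algebra in the library. *)
From HB Require Import structures.
From mathcomp Require Import all_boot all_order all_algebra.
From mathcomp Require Import all_classical all_reals all_analysis.

Set Implicit Arguments.
Unset Strict Implicit.
Unset Printing Implicit Defensive.

Import Order.TTheory GRing.Theory Num.Theory.
Import numFieldNormedType.Exports.

Local Open Scope classical_set_scope.
Local Open Scope ring_scope.

Section lebesgue_step.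
Context (R : realType) (n : nat).
Let T := measurableTypeR R.
Variable m : {sigma_finite_measure set (n.-tuple T) -> \bar R}.

Let cons1 (z : T * n.-tuple T) : n.+1.-tuple T := [tuple of z.1 :: z.2].

Let leb1 : {sigma_finite_measure set T -> \bar R} := @lebesgue_measure R.

Definition lebesgue_step : set (n.+1.-tuple T) -> \bar R :=
  pushforward (@lebesgue_measure R \x m)%E
    (fun z : T * n.-tuple T => [tuple of z.1 :: z.2]).

Let measurable_cons1 : measurable_fun setT cons1.
Proof. by apply: measurable_cons => //; exact: measurable_snd. Qed.

Let step0 : lebesgue_step set0 = 0%E.
Proof. by rewrite /lebesgue_step /pushforward preimage_set0 measure0. Qed.

Let step_ge0 A : (0 <= lebesgue_step A)%E.
Proof. exact: measure_ge0. Qed.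

Let step_sigma : semi_sigma_additive lebesgue_step.
Proof.
move=> F mF tF mUF; rewrite /lebesgue_step /pushforward preimage_bigcup.
apply: measure_semi_sigma_additive.
- by move=> k; rewrite -[X in measurable X]setTI; exact: measurable_cons1.
- apply/trivIsetP => /= i j _ _ ij; rewrite -preimage_setI.
  by move/trivIsetP : tF => /(_ _ _ _ _ ij) ->//; rewrite preimage_set0.
- by rewrite -preimage_bigcup -[X in measurable X]setTI;
    exact: measurable_cons1.
Qed.

HB.instance Definition _ :=
  isMeasure.Build _ _ _ lebesgue_step step0 step_ge0 step_sigma.

Let uncons (t : n.+1.-tuple T) : T * n.-tuple T :=
  (thead t, [tuple of behead t]).

Let measurable_uncons : measurable_fun setT uncons.
Proof.
apply/measurable_fun_pairP; split.
- exact: measurable_tnth.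
- exact: measurable_behead.
Qed.

Let step_sigma_finite : sigma_finite setT lebesgue_step.
Proof.
have /sigma_finiteP[F [FT ndF Foo]] := sigma_finiteT leb1.
have /sigma_finiteP[G [GT ndG Goo]] := sigma_finiteT m.
exists (fun k => uncons @^-1` (F k `*` G k)).
  rewrite predeqE => t; split=> // _.
  have [i _ Fi] : (\bigcup_i F i) (thead t) by rewrite -FT.
  have [j _ Gj] : (\bigcup_j G j) [tuple of behead t] by rewrite -GT.
  exists (maxn i j) => //; split=> /=.
  - by move: Fi; exact/subsetPset/ndF/leq_maxl.
  - by move: Gj; exact/subsetPset/ndG/leq_maxr.
move=> k; have [mF Fk] := Foo k; have [mG Gk] := Goo k; split.
  rewrite -[X in measurable X]setTI; apply: measurable_uncons => //.
  exact: measurableX.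
rewrite /lebesgue_step /pushforward -comp_preimage.
rewrite (_ : uncons \o _ = id); last first.
  apply/funext => -[x t]; rewrite /uncons /= theadE; congr pair.
  exact/val_inj.
rewrite preimage_id [ltLHS](product_measure1E leb1 m mF mG).
by rewrite lte_mul_pinfty// ge0_fin_numE.
Qed.

HB.instance Definition _ :=
  Measure_isSigmaFinite.Build _ _ _ lebesgue_step step_sigma_finite.

End lebesgue_step.

Fixpoint lebesgue_tuple (R : realType) (n : nat) :
    {sigma_finite_measure set (n.-tuple (measurableTypeR R)) -> \bar R} :=
  match n with
  | 0 => dirac ([tuple] : 0.-tuple (measurableTypeR R))
  | k.+1 => lebesgue_step (lebesgue_tuple R k)
  end.

Section euclidean.
Context (R : realType) (n : nat).
Implicit Types (O : set 'rV[R]_n) (f D : 'rV[R]_n -> R) (k : 'I_n).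

Definition row_of_tuple (t : n.-tuple (measurableTypeR R)) : 'rV[R]_n :=
  \row_i tnth t i.

Definition tuples_of O : set (n.-tuple (measurableTypeR R)) :=
  row_of_tuple @^-1` O.

Definition partial k f : 'rV[R]_n -> R := 'D_(delta_mx 0 k) f.

Fixpoint Cm_on (m : nat) O f : Prop :=
  (forall y, O y -> {for y, continuous f}) /\
  match m with
  | 0 => True
  | m'.+1 => forall k, (forall y, O y -> derivable f y (delta_mx 0 k)) /\
                       Cm_on m' O (partial k f)
  end.

Definition smooth_on O f : Prop := forall m, Cm_on m O f.

(* entry (k, l) is d(T_l)/d(y_k), so that v *m jac T y is the image of the
   row vector v under the differential of T at y *)
Definition jac (T : 'rV[R]_n -> 'rV[R]_n) (y : 'rV[R]_n) : 'M[R]_n :=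
  \matrix_(k, l) partial k (fun z => T z 0 l) y.

Definition Lp_loc (p : R) O f : Prop :=
  measurable_fun (tuples_of O) (f \o row_of_tuple) /\
  forall K : set 'rV[R]_n, compact K -> K `<=` O ->
    (\int[lebesgue_tuple R n]_(t in tuples_of K)
       (`|f (row_of_tuple t)| `^ p)%:E < +oo)%E.

Definition test_function O (eta : 'rV[R]_n -> R) : Prop :=
  smooth_on setT eta /\
  exists K : set 'rV[R]_n,
    [/\ compact K, K `<=` O & forall y, ~ K y -> eta y = 0].

Definition weak_partial O k f D : Prop :=
  forall eta, test_function O eta ->
    \int[lebesgue_tuple R n]_(t in tuples_of O)
      (f (row_of_tuple t) * partial k eta (row_of_tuple t)) =
    - \int[lebesgue_tuple R n]_(t in tuples_of O)
      (D (row_of_tuple t) * eta (row_of_tuple t)).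

Definition sobolev1_loc (p : R) O f : Prop :=
  Lp_loc p O f /\
  forall k, exists D, Lp_loc p O D /\ weak_partial O k f D.

(* a representative of the weak derivative, which is unique up to a.e. equality
   among locally integrable functions *)
Definition wpartial O k f : 'rV[R]_n -> R :=
  xget (fun=> 0) [set D | Lp_loc 1 O D /\ weak_partial O k f D].

End euclidean.

(* The atlas is countable, which
   encodes second countability; chart domains may be empty, so that finite
   atlases are covered. *)
Record manifold (R : realType) (n : nat) (M : ptopologicalType) := Manifold {
  dom : nat -> set M ;
  coord : nat -> M -> 'rV[R]_n ;
  point_at : nat -> 'rV[R]_n -> M ;
  dom_open : forall i, open (dom i) ;
  cover : forall x, exists i, `[< dom i x >] ;
  coord_open : forall i, open (coord i @` dom i) ;
  coordK : forall i x, dom i x -> point_at i (coord i x) = x ;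
  coord_continuous : forall i x, dom i x -> {for x, continuous (coord i)} ;
  point_at_continuous : forall i y, (coord i @` dom i) y ->
    {for y, continuous (point_at i)} ;
  transition_smooth : forall i j (k : 'I_n),
    smooth_on (coord i @` (dom i `&` dom j))
      (fun y => coord j (point_at i y) 0 k)
}.

Section manifolds.
Context (R : realType) (n : nat) (M : ptopologicalType).
Variable X : manifold R n M.

Definition transition (i j : nat) (y : 'rV[R]_n) : 'rV[R]_n :=
  coord X j (point_at X i y).

(* the first chart of the atlas around x; a countable choice keeps the
   functions defined below Borel measurable *)
Definition chart_at (x : M) : nat := ex_minn (cover X x).

Record riemannian_metric := RiemannianMetric {
  (* Gram matrix of the coordinate vector fields of each chart *)
  gram : nat -> 'rV[R]_n -> 'M[R]_n ;
  gram_sym : forall i y, (coord X i @` dom X i) y -> (gram i y)^T = gram i y ;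
  gram_gt0 : forall i y (v : 'rV[R]_n), (coord X i @` dom X i) y ->
    v != 0 -> 0 < (v *m gram i y *m v^T) 0 0 ;
  gram_smooth : forall i k l,
    smooth_on (coord X i @` dom X i) (fun y => gram i y k l) ;
  gram_transition : forall i j y, (coord X i @` (dom X i `&` dom X j)) y ->
    gram i y = jac (transition i j) y *m gram j (transition i j y)
               *m (jac (transition i j) y)^T
}.

Definition borel : Type := g_sigma_algebraType (@open M).
HB.instance Definition _ := Measurable.on borel.

Definition riemannian_volume (g : riemannian_metric)
    (vol : {measure set borel -> \bar R}) : Prop :=
  forall i (B : set M), measurable (B : set borel) -> B `<=` dom X i ->
    vol B = (\int[lebesgue_tuple R n]_(t in tuples_of (coord X i @` B))
               (Num.sqrt (\det (gram g i (row_of_tuple t))))%:E)%E.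

(* A smooth real vector bundle of rank r, as a family of fibres together with
   fibrewise linear local trivializations whose transition functions are
   smooth; these determine the topology and smooth structure of the total
   space. *)
Record vector_bundle (r : nat) := VectorBundle {
  fiber : M -> lmodType R ;
  vdom : nat -> set M ;
  triv : nat -> forall x, {linear fiber x -> 'cV[R]_r} ;
  frame : nat -> forall x, 'cV[R]_r -> fiber x ;
  vdom_open : forall a, open (vdom a) ;
  vcover : forall x, exists a, `[< vdom a x >] ;
  trivK : forall a x, vdom a x -> cancel (triv a x) (frame a x) ;
  frameK : forall a x, vdom a x -> cancel (frame a x) (triv a x) ;
  vtransition_smooth : forall i a b (s t : 'I_r),
    smooth_on (coord X i @` (dom X i `&` vdom a `&` vdom b))
      (fun y => triv b (point_at X i y)
                  (frame a (point_at X i y) (delta_mx t 0)) s 0)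
}.

Section bundles.
Context (r : nat).
Variable E : vector_bundle r.

(* matrix of the change of trivialization from a to b, in the chart i *)
Definition vtransition (i a b : nat) (y : 'rV[R]_n) : 'M[R]_r :=
  \matrix_(s, t) triv E b (point_at X i y)
                   (frame E a (point_at X i y) (delta_mx t 0)) s 0.

Definition triv_at (x : M) : nat := ex_minn (vcover E x).

Record fiber_metric := FiberMetric {
  inner : forall x, fiber E x -> fiber E x -> R ;
  inner_linear : forall x (c : R) (u v w : fiber E x),
    inner (c *: u + v) w = c * inner u w + inner v w ;
  inner_sym : forall x (u v : fiber E x), inner u v = inner v u ;
  inner_gt0 : forall x (u : fiber E x), u != 0 -> 0 < inner u u ;
  inner_smooth : forall i a (s t : 'I_r),
    smooth_on (coord X i @` (dom X i `&` vdom E a))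
      (fun y => @inner (point_at X i y)
                  (frame E a (point_at X i y) (delta_mx s 0))
                  (frame E a (point_at X i y) (delta_mx t 0)))
}.

Definition fiber_gram (h : fiber_metric) (a : nat) (x : M) : 'M[R]_r :=
  \matrix_(s, t) inner h (frame E a x (delta_mx s 0))
                         (frame E a x (delta_mx t 0)).

(* trace (S^T o U), where the transpose is the adjoint for the inner product
   with Gram matrix H, i.e. H^-1 *m S^T *m H *)
Definition hom_inner (H S U : 'M[R]_r) : R :=
  \tr (invmx H *m S^T *m H *m U).

(* coordinate image of the domain on which both the chart i and the
   trivialization a are defined *)
Definition region (i a : nat) : set 'rV[R]_n :=
  coord X i @` (dom X i `&` vdom E a).

(* A connection with measurable coefficients, up to a.e. equality:
   nabla_k u = d_k u + form i a k *m u in the chart i and trivialization a. *)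
Record connection := Connection {
  form : nat -> nat -> 'I_n -> 'rV[R]_n -> 'M[R]_r ;
  form_measurable : forall i a k s t,
    measurable_fun (tuples_of (region i a))
      (fun z => form i a k (row_of_tuple z) s t) ;
  form_chart : forall i j a k,
    {ae lebesgue_tuple R n, forall z,
      let y := row_of_tuple z in
      (coord X i @` (dom X i `&` dom X j `&` vdom E a)) y ->
      form i a k y =
        \sum_l jac (transition i j) y k l *: form j a l (transition i j y)} ;
  form_gauge : forall i a b k,
    {ae lebesgue_tuple R n, forall z,
      let y := row_of_tuple z in
      (coord X i @` (dom X i `&` vdom E a `&` vdom E b)) y ->
      form i b k y *m vtransition i a b y =
        vtransition i a b y *m form i a k y
        - \matrix_(s, t) partial k (fun y' => vtransition i a b y' s t) y}
}.

(* L^p_1(E): on a compact manifold, p-integrability of the connection and of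
   its first derivatives amounts to that of its coefficients on the compact
   subsets of charts. *)
Definition sobolev_connection (p : R) (A : connection) : Prop :=
  forall i a k s t, sobolev1_loc p (region i a) (fun y => form A i a k y s t).

Definition Wp (p : R) (A : connection) : Prop :=
  sobolev_connection p A /\ sobolev_connection 2 A.

(* R(d_k, d_l) in the chart i and trivialization a, with weak derivatives *)
Definition curvature_coef (A : connection) (i a : nat) (k l : 'I_n)
    (y : 'rV[R]_n) : 'M[R]_r :=
  (\matrix_(s, t)
     (wpartial (region i a) k (fun z => form A i a l z s t) y
      - wpartial (region i a) l (fun z => form A i a k z s t) y))
  + (form A i a k y *m form A i a l y - form A i a l y *m form A i a k y).

Definition curvature (A : connection) (i a : nat) (y v w : 'rV[R]_n) :
    'M[R]_r :=
  \sum_k \sum_l (v 0 k * w 0 l) *: curvature_coef A i a k l y.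

(* the rows of e are the coordinates of an orthonormal basis *)
Definition orthonormal (G e : 'M[R]_n) : Prop := e *m G *m e^T = 1%:M.

Definition onbasis (G : 'M[R]_n) : 'M[R]_n := xget 0 [set e | orthonormal G e].

Definition curvature_sqnorm (g : riemannian_metric) (h : fiber_metric)
    (A : connection) (x : M) : R :=
  let i := chart_at x in
  let a := triv_at x in
  let y := coord X i x in
  let e := onbasis (gram g i y) in
  \sum_(j < n) \sum_(k < n | (j < k)%N)
    hom_inner (fiber_gram h a x) (curvature A i a y (row j e) (row k e))
                                 (curvature A i a y (row j e) (row k e)).

Definition curvature_norm (g : riemannian_metric) (h : fiber_metric)
    (A : connection) (x : M) : R :=
  Num.sqrt (curvature_sqnorm g h A x).

Definition YM (g : riemannian_metric) (h : fiber_metric)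
    (vol : {measure set borel -> \bar R}) (A : connection) : \bar R :=
  (\int[vol]_x (curvature_norm g h A x ^+ 2 / 2)%:E)%E.

Definition YMp (p : R) (g : riemannian_metric) (h : fiber_metric)
    (vol : {measure set borel -> \bar R}) (A : connection) : \bar R :=
  (\int[vol]_x (curvature_norm g h A x `^ p / p)%:E)%E.

End bundles.
End manifolds.

(* Main.v *)
From HB Require Import structures.
From mathcomp Require Import all_boot all_order all_algebra.
From mathcomp Require Import all_classical all_reals all_analysis.
From mathcomp Require Import measurable_realfun lra ring.
Require Import Defs.
Import Order.TTheory GRing.Theory Num.Theory.
Import numFieldNormedType.Exports.
Local Open Scope classical_set_scope.
Local Open Scope ring_scope.

(** The theorem is the comparison of the quadratic mean with the p-mean of the
    function f = ||R|| for the normalized Riemannian volume, i.e. Jensen's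
    inequality for u = f ^ 2 and the convex function t |-> t ^ q, q = p / 2.

    Jensen's inequality comes from the tangent of t ^ q at the mean m of u, which
    lies below t ^ q (le_powR_tangent), strictly so away from m when q > 1
    (lt_powR_tangent). The integral of the gap between u ^ q and this tangent
    is the defect of the inequality times the volume. This gives the inequality (jensen_powR_fin),
    and in the case of equality a nonnegative function with integral zero, so
    that u = m almost everywhere (jensen_powR_eq). Conversely, both means of a
    constant agree (jensen_powR_cst).

    Two facts have to be known about the geometry. The first is that the volume
    is finite (finite_volume): it is locally finite, since its density in a chart
    is continuous, and M is compact. The second is that f is Borel measurable
    (measurable_curvature_norm); otherwise a vanishing integral would not
    determine f almost everywhere. The coefficients of the connection and their
    weak derivatives are measurable in each chart, but f is defined with an
    arbitrary orthonormal basis of each tangent space, which need not depend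
    measurably on the point. The norm does not depend on that basis: it is the
    contraction of the curvature with the inverse Gram matrix
    (orthonormal_sqnormE), whose entries are continuous. Orthonormal bases do
    exist since the metric is positive definite (orthonormal_exists). *)

Set Implicit Arguments.
Unset Strict Implicit.
Unset Printing Implicit Defensive.

(** * Tangents of power functions *)

Lemma le_expR_tangent (R : realType) (y a : R) :
  expR y * (1 + a) <= expR (y + a).
Proof. by rewrite expRD ler_pM2l ?expR_gt0// expR_ge1Dx. Qed.

Lemma lt_expR_tangent (R : realType) (y a : R) : a != 0 ->
  expR y * (1 + a) < expR (y + a).
Proof. by move=> a0; rewrite expRD ltr_pM2l ?expR_gt0// expR_gt1Dx. Qed.

(** Bernoulli's inequality with a real exponent, from the convexity of the
    exponential: with s = exp y, the point y is the mean of q y and 0 with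
    weights 1/q and 1 - 1/q, and the tangent of exp at y lies below exp at both
    of these points. *)
Lemma bernoulli_powR (R : realType) (q s : R) : 1 <= q -> 0 <= s ->
  1 + q * (s - 1) <= s `^ q.
Proof.
move=> q1; rewrite le_eqVlt => /predU1P[<-|s0].
  by rewrite powR0 ?gt_eqF//; lra.
have [y <-] := expR_total s0.
rewrite -expRM (_ : y * q = y + (q - 1) * y); last by ring.
have at_qy := le_expR_tangent y ((q - 1) * y).
have := le_expR_tangent y (- y); rewrite subrr expR0 => at_0.
have : (q - 1) * (expR y * (1 - y)) <= (q - 1) * 1.
  by rewrite ler_wpM2l// subr_ge0.
lra.
Qed.

Lemma bernoulli_powR_strict (R : realType) (q s : R) : 1 < q -> 0 <= s ->
  s != 1 -> 1 + q * (s - 1) < s `^ q.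
Proof.
move=> q1; rewrite le_eqVlt => /predU1P[<- _|s0].
  by rewrite powR0 ?gt_eqF//; lra.
have [y <-] := expR_total s0.
rewrite -expRM (_ : y * q = y + (q - 1) * y); last by ring.
move=> y1; have y0 : y != 0 by apply: contraNneq y1 => ->; rewrite expR0.
have at_qy := le_expR_tangent y ((q - 1) * y).
have := @lt_expR_tangent _ y (- y); rewrite oppr_eq0 subrr expR0 => /(_ y0) at_0.
have : (q - 1) * (expR y * (1 - y)) < (q - 1) * 1.
  by rewrite ltr_pM2l// subr_gt0.
lra.
Qed.

Definition powR_tangent (R : realType) (q m t : R) : R :=
  m `^ q + q * m `^ (q - 1) * (t - m).

Lemma powR_tangent_scale (R : realType) (q m t : R) : 0 < m ->
  powR_tangent q m t = m `^ q * (1 + q * (t / m - 1)).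
Proof.
move=> m0; rewrite /powR_tangent powRB; last by rewrite (gt_eqF m0) implybT.
by rewrite powRr1 ?ltW//; field; rewrite gt_eqF.
Qed.

Lemma powR_scale (R : realType) (q m t : R) : 0 < m -> 0 <= t ->
  t `^ q = m `^ q * (t / m) `^ q.
Proof.
move=> m0 t0; rewrite -powRM ?divr_ge0// ?ltW//.
by rewrite mulrCA mulfV ?mulr1// gt_eqF.
Qed.

(** At m = 0 the slope is 0 ^ (q - 1), which is 1 for q = 1 and 0 for q > 1. *)
Lemma powR_tangent0 (R : realType) (q t : R) : 1 <= q -> 0 <= t ->
  powR_tangent q 0 t = if q == 1 then t else 0.
Proof.
move=> q1 t0; rewrite /powR_tangent subr0 powR0; last first.
  by rewrite gt_eqF// (lt_le_trans ltr01).
rewrite add0r; have [->|qn1] := eqVneq q 1.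
  by rewrite subrr powRr0 !mul1r.
by rewrite powR0 ?subr_eq0// mulr0 mul0r.
Qed.

Lemma le_powR_tangent (R : realType) (q m t : R) : 1 <= q -> 0 <= m -> 0 <= t ->
  powR_tangent q m t <= t `^ q.
Proof.
move=> q1; rewrite le_eqVlt => /predU1P[<-|m0] t0.
  rewrite powR_tangent0//; case: eqP => [->|_]; last exact: powR_ge0.
  by rewrite powRr1.
rewrite powR_tangent_scale// (powR_scale q m0 t0)// ler_pM2l ?powR_gt0//.
by rewrite bernoulli_powR// divr_ge0// ltW.
Qed.

Lemma lt_powR_tangent (R : realType) (q m t : R) : 1 < q -> 0 <= m -> 0 <= t ->
  t != m -> powR_tangent q m t < t `^ q.
Proof.
move=> q1; rewrite le_eqVlt => /predU1P[<-|m0] t0 tm.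
  by rewrite powR_tangent0 ?(ltW q1)// (gt_eqF q1) powR_gt0// lt0r tm.
rewrite powR_tangent_scale// (powR_scale q m0 t0)// ltr_pM2l ?powR_gt0//.
rewrite bernoulli_powR_strict ?divr_ge0// ?ltW//.
by apply: contraNneq tm => tm1; rewrite -(divfK (lt0r_neq0 m0) t) tm1 mul1r.
Qed.

(** * Jensen's inequality for powers, with its equality case *)

Section jensen.
Context d (T : measurableType d) (R : realType).
Variables (mu : {measure set T -> \bar R}) (V q : R) (u : T -> R).
Hypotheses (V0 : 0 < V) (muV : mu setT = V%:E) (q1 : 1 <= q).
Hypotheses (mfu : measurable_fun setT u) (u0 : forall x, 0 <= u x).
Hypothesis uq_fin : (\int[mu]_x (u x `^ q)%:E < +oo)%E.

Let integrable_powR : mu.-integrable setT (fun x => (u x `^ q)%:E).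
Proof.
apply/integrableP; split.
  apply/measurable_EFinP.
  apply: (measurableT_comp (f:= (@powR R ^~ q))) => //; exact: measurable_powR.
under eq_integral do rewrite gee0_abs ?lee_fin ?powR_ge0//.
exact: uq_fin.
Qed.

Let integrable_cst (c : R) : mu.-integrable setT (fun=> c%:E).
Proof.
apply/integrableP; split; first exact: measurable_cst.
by rewrite (@integral_cst _ _ _ mu setT measurableT `|c%:E|%E) muV/= ltry.
Qed.

Let integrable_base : mu.-integrable setT (EFin \o u).
Proof.
apply: (@le_integrable _ _ _ _ _ _ _ (fun x => 1%:E + (u x `^ q)%:E)%E) => //.
- exact/measurable_EFinP.
- move=> x _; rewrite -EFinD /= lee_fin !ger0_norm ?addr_ge0 ?powR_ge0//.
  have [u1|u1] := lerP (u x) 1.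
    by rewrite (le_trans u1)// lerDl powR_ge0.
  by rewrite (le_trans (le1r_powR (ltW u1) q1))// lerDr.
by apply: integrableD => //; exact: integrable_cst.
Qed.

Let m : R := fine (\int[mu]_x (u x)%:E) / V.

Let integral_base : (\int[mu]_x (u x)%:E = (m * V)%:E)%E.
Proof.
rewrite /m divfK ?gt_eqF// fineK//.
by apply: integrable_fin_num => //; exact: integrable_base.
Qed.

Let m0 : 0 <= m.
Proof. by rewrite divr_ge0 ?(ltW V0)// fine_ge0// integral_ge0// => x _; rewrite lee_fin. Qed.

(** The gap between u ^ q and the tangent at the mean m of u is nonnegative, and
    its integral is the defect of Jensen's inequality multiplied by V. *)
Let gap (x : T) : R := u x `^ q - powR_tangent q m (u x).

Let gap_ge0 x : 0 <= gap x.
Proof. by rewrite subr_ge0 le_powR_tangent. Qed.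

Let I := fine (\int[mu]_x (u x `^ q)%:E).

Let integral_powR : (\int[mu]_x (u x `^ q)%:E = I%:E)%E.
Proof. by rewrite fineK//; exact: integrable_fin_num. Qed.

Let integral_gap : (\int[mu]_x (gap x)%:E = (I - V * m `^ q)%:E)%E.
Proof.
set k := q * m `^ (q - 1).
have -> : (fun x => (gap x)%:E) =
    ((fun x => (u x `^ q)%:E) \+
     ((fun x => (- k)%:E * (u x)%:E) \+ (fun=> (k * m - m `^ q)%:E)))%E.
  apply/funext => x /=; rewrite -!(EFinM, EFinD) /gap /powR_tangent -/k.
  by congr EFin; ring.
rewrite integralD//; last first.
  by apply: integrableD => //; exact: integrableZl.
rewrite integralD//; last exact: integrableZl.
rewrite integralZl// integral_base integral_powR.
rewrite (@integral_cst _ _ _ mu setT measurableT (k * m - m `^ q)%:E) muV.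
by rewrite -!(EFinM, EFinD); congr EFin; ring.
Qed.

Lemma jensen_powR_fin :
  (((V^-1)%:E * \int[mu]_x (u x)%:E) `^ q <=
   (V^-1)%:E * \int[mu]_x (u x `^ q)%:E)%E.
Proof.
rewrite integral_base integral_powR -!EFinM poweR_EFin lee_fin.
have : (0 <= \int[mu]_x (gap x)%:E)%E.
  by apply: integral_ge0 => x _; rewrite lee_fin.
rewrite integral_gap lee_fin subr_ge0 (mulrC V^-1 (m * V)) mulfK ?gt_eqF//.
by rewrite ler_pdivlMl.
Qed.

(** If the inequality is an equality, the nonnegative gap has integral zero, so
    it vanishes almost everywhere; as t |-> t ^ q is strictly convex, this
    happens only where u equals its mean. *)
Lemma jensen_powR_eq : 1 < q ->
  (((V^-1)%:E * \int[mu]_x (u x)%:E) `^ q =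
   (V^-1)%:E * \int[mu]_x (u x `^ q)%:E)%E ->
  {ae mu, forall x, u x = m}.
Proof.
move=> q1'; rewrite integral_base integral_powR -!EFinM poweR_EFin => -[].
rewrite (mulrC V^-1 (m * V)) mulfK ?gt_eqF// => mI.
have mgap : measurable_fun setT (fun x => (gap x)%:E).
  apply/measurable_EFinP; apply: measurable_funB.
    exact: (measurableT_comp (measurable_powR q)).
  apply: measurable_funD => //; apply: measurable_funM => //.
  exact: measurable_funB.
have : (\int[mu]_x `|(gap x)%:E| = 0)%E.
  under eq_integral do rewrite gee0_abs ?lee_fin//.
  by rewrite integral_gap mI mulrA mulfV ?gt_eqF// mul1r subrr.
move=> /(ae_eq_integral_abs mu measurableT mgap).
apply: filterS => x /(_ Logic.I) [gap0].
apply/eqP; apply: contraPT isT => um.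
have := lt_powR_tangent q1' m0 (u0 x) um.
by rewrite -subr_gt0 -/(gap x) gap0 ltxx.
Qed.

End jensen.

Lemma jensen_powR_cst d (T : measurableType d) (R : realType)
    (mu : {measure set T -> \bar R}) (V q : R) (u : T -> R) (k : R) :
  0 < V -> mu setT = V%:E -> measurable_fun setT u -> (forall x, 0 <= u x) ->
  {ae mu, forall x, u x = k} ->
  (((V^-1)%:E * \int[mu]_x (u x)%:E) `^ q =
   (V^-1)%:E * \int[mu]_x (u x `^ q)%:E)%E.
Proof.
move=> V0 muV mfu u0 uk.
(* |k| rather than k: a negative k is possible only a priori, and u x = k
   gives u x = |k| in all cases. *)
have avgE (w : R -> R) : measurable_fun setT w -> (forall t, 0 <= t -> 0 <= w t) ->
    ((V^-1)%:E * \int[mu]_x (w (u x))%:E = (w `|k|)%:E)%E.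
  move=> mw w0.
  rewrite (@ge0_ae_eq_integral _ _ _ mu setT _ (fun=> (w `|k|)%:E))//.
  - rewrite (@integral_cst _ _ _ mu setT measurableT (w `|k|)%:E) muV.
    by rewrite -!EFinM mulrCA mulVf ?mulr1// gt_eqF.
  - by apply/measurable_EFinP; exact: (measurableT_comp (f := w)).
  - by move=> x _; rewrite lee_fin w0.
  - by move=> x _; rewrite lee_fin w0.
  - by apply: filterS uk => x ukx _; rewrite -ukx ger0_norm.
rewrite (avgE id)//.
rewrite (avgE (@powR R ^~ q)) ?poweR_EFin//; last by move=> t _; exact: powR_ge0.
Qed.

(** * Comparison of the quadratic mean and the p-mean *)

Section power_mean.
Local Open Scope ereal_scope.
Context d (T : measurableType d) (R : realType).
Variables (mu : {measure set T -> \bar R}) (p : R) (f : T -> R).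
Hypotheses (mu_fin : mu setT < +oo) (hp : (2 <= p)%R).
Hypotheses (mf : measurable_fun setT f) (f0 : forall x, (0 <= f x)%R).

Let p0 : (0 < p)%R. Proof. exact: lt_le_trans hp. Qed.

Let lhs := (p^-1)%:E * (2%:E / mu setT * \int[mu]_x (f x ^+ 2 / 2)%:E) `^ (p / 2).
Let rhs := (mu setT)^-1 * \int[mu]_x (f x `^ p / p)%:E.

Let mf2 : measurable_fun setT (fun x => f x ^+ 2)%R.
Proof. exact: measurable_funX. Qed.

Let sqr_powR x : ((f x ^+ 2) `^ (p / 2) = f x `^ p)%R.
Proof. by rewrite -powR_mulrn// -powRrM mulrC divfK. Qed.

Let mfp : measurable_fun setT (fun x => f x `^ p)%R.
Proof.
by apply: (measurableT_comp (f := (@powR R ^~ p))) => //; exact: measurable_powR.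
Qed.

(** When the total mass is zero, 2 / mu setT and (mu setT)^-1 are +oo, but they
    multiply integrals that are zero, and +oo * 0 = 0. *)
Lemma power_mean_null : mu setT = 0 -> lhs = rhs.
Proof.
move=> mu0.
have int0 (w : T -> R) : measurable_fun setT w -> (forall x, (0 <= w x)%R) ->
    \int[mu]_x (w x)%:E = 0.
  move=> mw w0; rewrite -[RHS](integral_abs_eq0 measurableT _ mu0 (f := EFin \o w)).
    by apply: eq_integral => x _; rewrite gee0_abs// lee_fin.
  exact/measurable_EFinP.
rewrite /lhs /rhs !int0.
- by rewrite !mule0 poweR0r ?mule0// gt_eqF// divr_gt0.
- exact: measurable_funM.
- by move=> x; rewrite divr_ge0 ?powR_ge0// ltW.
- exact: measurable_funM.
- by move=> x; rewrite divr_ge0 ?sqr_ge0.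
Qed.

Lemma power_mean_lhsE (V : R) : (0 < V)%R -> mu setT = V%:E ->
  lhs = (p^-1)%:E * ((V^-1)%:E * \int[mu]_x (f x ^+ 2)%:E) `^ (p / 2).
Proof.
move=> V0 muV; rewrite /lhs muV inver gt_eqF//.
under eq_integral do rewrite EFinM.
rewrite ge0_integralZr//; last 2 first.
- exact/measurable_EFinP.
- by move=> x _; rewrite lee_fin sqr_ge0.
congr (_ * (_ `^ _)).
by rewrite [X in _ * X]muleC muleA -!EFinM mulrAC mulfV// mul1r.
Qed.

Let integral_powE : \int[mu]_x (f x `^ p / p)%:E =
  (p^-1)%:E * \int[mu]_x ((f x ^+ 2) `^ (p / 2))%:E.
Proof.
under eq_integral do rewrite EFinM muleC.
rewrite ge0_integralZl//; last 3 first.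
- exact/measurable_EFinP.
- by move=> x _; rewrite lee_fin powR_ge0.
- by rewrite lee_fin invr_ge0 ltW.
by under [in RHS]eq_integral do rewrite sqr_powR.
Qed.

Lemma power_mean_rhsE (V : R) : (0 < V)%R -> mu setT = V%:E ->
  rhs = (p^-1)%:E * ((V^-1)%:E * \int[mu]_x ((f x ^+ 2) `^ (p / 2))%:E).
Proof.
by move=> V0 muV; rewrite /rhs muV inver gt_eqF// integral_powE muleCA.
Qed.

(** Jensen's inequality for u = f ^ 2 and the exponent p / 2. *)
Lemma power_mean_le :
  [/\ lhs <= rhs,
      (exists c, {ae mu, forall x, f x = c}) -> lhs = rhs &
      (2 < p)%R -> \int[mu]_x (f x `^ p / p)%:E < +oo -> lhs = rhs ->
      exists c, {ae mu, forall x, f x = c}].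
Proof.
have [mu0|mun0] := eqVneq (mu setT) 0.
  split=> [|//|_ _ _]; first by rewrite power_mean_null.
    by rewrite power_mean_null.
  by exists 0%R, setT.
have [V muV] : exists V, mu setT = V%:E.
  by exists (fine (mu setT)); rewrite fineK// ge0_fin_numE.
have V0 : (0 < V)%R by rewrite -lte_fin -muV lt0e mun0 measure_ge0.
rewrite (power_mean_lhsE V0 muV) (power_mean_rhsE V0 muV).
have q1 : (1 <= p / 2)%R by rewrite ler_pdivlMr// mul1r.
have u0 x : (0 <= f x ^+ 2)%R by exact: sqr_ge0.
have pV0 : (0 < p^-1)%R by rewrite invr_gt0.
split.
- rewrite lee_pmul2l//.
  have [fin|] := ltP (\int[mu]_x ((f x ^+ 2) `^ (p / 2))%:E) +oo.
    exact: jensen_powR_fin.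
  rewrite leye_eq => /eqP ->.
  by rewrite gt0_muley ?lte_fin ?invr_gt0// leey.
- move=> [c fc]; congr (_ * _).
  apply: (@jensen_powR_cst _ _ _ _ _ _ _ (c ^+ 2)) => //.
  by apply: filterS fc => x ->.
- move=> p2 fp_fin /(congr1 (mule p%:E)).
  rewrite !(muleA p%:E) -EFinM mulfV ?gt_eqF// !mul1e => eq_jensen.
  have q1' : (1 < p / 2)%R by rewrite ltr_pdivlMr// mul1r.
  have fin : \int[mu]_x ((f x ^+ 2) `^ (p / 2))%:E < +oo.
    rewrite ltey; apply/eqP => oo; move: fp_fin.
    by rewrite integral_powE oo gt0_muley ?lte_fin.
  exists (Num.sqrt (fine (\int[mu]_x (f x ^+ 2)%:E) / V)).
  apply: filterS (jensen_powR_eq V0 muV q1 mf2 u0 fin q1' eq_jensen) => x fx.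
  by rewrite -fx sqrtr_sqr ger0_norm.
Qed.

End power_mean.

(** * Measurability of matrix-valued maps *)

Section measurable_matrices.
Context d (T : measurableType d) (R : realType) (D : set T).

Definition measurable_mx m n (A : T -> 'M[R]_(m, n)) : Prop :=
  forall i j, measurable_fun D (fun x => A x i j).

Lemma measurable_mx_det n (A : T -> 'M[R]_n) :
  measurable_mx A -> measurable_fun D (fun x => \det (A x)).
Proof.
move=> mA; rewrite /determinant; apply: measurable_sum => s.
by apply: measurable_funM => //; apply: measurable_prod => i _; exact: mA.
Qed.

Lemma measurable_inv (f : T -> R) :
  measurable_fun D f -> measurable_fun D (fun x => (f x)^-1).
Proof.
move=> mf.
(* 1 / a = a * (a ^ 2) ^ (-1), which also holds for a = 0 and reduces the claim
   to the measurability of real powers. *)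
rewrite (_ : (fun x => _) = (fun x => f x * (f x ^+ 2) `^ (-1))).
  apply: measurable_funM => //.
  apply: (measurableT_comp (f := (@powR R ^~ (-1)))).
    exact: measurable_powR.
  exact: measurable_funX.
apply/funext => x; rewrite powR_inv1 ?sqr_ge0//.
have [->|fx0] := eqVneq (f x) 0; first by rewrite invr0 mul0r.
by field.
Qed.

Lemma measurable_mx_inv n (A : T -> 'M[R]_n) :
  (forall x, D x -> A x \in unitmx) ->
  measurable_mx A -> measurable_mx (fun x => invmx (A x)).
Proof.
move=> uA mA i j.
apply: (@eq_measurable_fun _ _ _ _ _ (fun x => (\det (A x))^-1 * (\adj (A x) i j))).
  by move=> x /set_mem /uA uAx; rewrite /invmx uAx [RHS]mxE.
apply: measurable_funM; first exact/measurable_inv/measurable_mx_det.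
rewrite /adjugate /cofactor.
under eq_fun do rewrite mxE.
apply: measurable_funM => //; apply: measurable_mx_det => k l.
under eq_fun do rewrite !mxE.
exact: mA.
Qed.

Lemma measurable_mx_mul m n p (A : T -> 'M[R]_(m, n)) (B : T -> 'M[R]_(n, p)) :
  measurable_mx A -> measurable_mx B -> measurable_mx (fun x => A x *m B x).
Proof.
move=> mA mB i j; under eq_fun do rewrite mxE.
by apply: measurable_sum => k; apply: measurable_funM; [exact: mA|exact: mB].
Qed.

Lemma measurable_mx_tr m n (A : T -> 'M[R]_(m, n)) :
  measurable_mx A -> measurable_mx (fun x => (A x)^T).
Proof. by move=> mA i j; under eq_fun do rewrite mxE; exact: mA. Qed.

Lemma measurable_mxD m n (A B : T -> 'M[R]_(m, n)) :
  measurable_mx A -> measurable_mx B -> measurable_mx (fun x => A x + B x).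
Proof.
move=> mA mB i j; under eq_fun do rewrite mxE.
by apply: measurable_funD; [exact: mA|exact: mB].
Qed.

Lemma measurable_mxN m n (A : T -> 'M[R]_(m, n)) :
  measurable_mx A -> measurable_mx (fun x => - A x).
Proof.
move=> mA i j; under eq_fun do rewrite mxE.
by apply: measurable_funN; exact: mA.
Qed.

Lemma measurable_hom_inner r (H S U : T -> 'M[R]_r) :
  (forall x, D x -> H x \in unitmx) ->
  measurable_mx H -> measurable_mx S -> measurable_mx U ->
  measurable_fun D (fun x => hom_inner (H x) (S x) (U x)).
Proof.
move=> uH mH mS mU; rewrite /hom_inner /mxtrace; apply: measurable_sum => i.
apply: measurable_mx_mul => //; apply: measurable_mx_mul => //.
by apply: measurable_mx_mul; [exact: measurable_mx_inv|exact: measurable_mx_tr].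
Qed.

End measurable_matrices.

(** * Borel sets of coordinates *)

Section open_tuples.
Context (R : realType) (n : nat).

Lemma row_ballE (y z : 'rV[R]_n) e : 0 < e ->
  ball y e z <-> forall j, ball (y 0 j) e (z 0 j).
Proof.
move=> e0; split=> [[_ yz] j|yz]; first exact: yz.
by split => // i j; rewrite !ord1.
Qed.

Lemma measurable_tuples_of_ball (y : 'rV[R]_n) e : 0 < e ->
  measurable (tuples_of (ball y e)).
Proof.
move=> e0; rewrite (_ : tuples_of _ =
    \bigcap_(j in [set: 'I_n]) (@tnth n (measurableTypeR R) ^~ j) @^-1` (ball (y 0 j) e)).
  apply: fin_bigcap_measurable => //.
  by move=> j _; rewrite -[X in measurable X]setTI; apply: measurable_tnth => //;
    exact: measurable_ball.
apply/seteqP; split=> [t /row_ballE + j _|t tj].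
  by move=> /(_ e0 j); rewrite mxE.
by apply/row_ballE => // j; rewrite mxE; exact: tj.
Qed.

(** Tuples carry the product sigma-algebra, row vectors the norm topology: an open
    set is a countable union of balls with rational centres and radii 1 / (k + 1),
    and balls for the sup norm are products of intervals. *)
Lemma measurable_tuples_of (O : set 'rV[R]_n) : open O -> measurable (tuples_of O).
Proof.
move=> oO.
pose box (c : {ffun 'I_n -> rat} * nat) : set 'rV[R]_n :=
  ball (\row_j (ratr (c.1 j) : R)) (c.2.+1%:R^-1).
pose F (c : {ffun 'I_n -> rat} * nat) :=
  if `[< box c `<=` O >] then tuples_of (box c) else set0.
have -> : tuples_of O = \bigcup_c F c.
  apply/seteqP; split=> [t Ot|t [c _]]; last first.
    rewrite /F; case: asboolP => // cO; exact: cO.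
  have /nbhs_ballP[e e0 eO] : nbhs (row_of_tuple t) O by exact: open_nbhs_nbhs.
  have [k ke] : exists k : nat, k.+1%:R^-1 < e / 2.
    by have /ltr_add_invr[k] := divr_gt0 e0 (ltr0n R 2); rewrite add0r; exists k.
  have k0 : 0 < k.+1%:R^-1 :> R by rewrite invr_gt0.
  have /choice[c ct] (j : 'I_n) : exists q : rat, ball (ratr q : R) k.+1%:R^-1 (tnth t j).
    have /rat_in_itvoo[q] : tnth t j - k.+1%:R^-1 < tnth t j + k.+1%:R^-1.
      by rewrite ltrD2l (lt_trans _ k0)// oppr_lt0.
    by rewrite in_itv/= => tq; exists q; rewrite /ball/= ltr_distl.
  exists (finfun c, k) => //; rewrite /F asboolT /tuples_of /=.
    by apply/row_ballE => // j; rewrite !mxE ffunE.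
  move=> z /row_ballE zc; apply: eO; apply/row_ballE => // j.
  rewrite mxE; apply: (@ball_splitr _ _ (ratr (c j) : R)).
    by apply: (le_ball (ltW ke)); exact: ct.
  by apply: (le_ball (ltW ke)); have := zc k0 j; rewrite mxE ffunE.
apply: countable_bigcupT_measurable; first exact: countableP.
move=> c; rewrite /F; case: asboolP => // _.
by apply: measurable_tuples_of_ball; rewrite invr_gt0.
Qed.

End open_tuples.

(** * Orthonormal bases of a positive definite form *)

(** The rows orthogonal to the first basis vector, on which the form with the
    block matrix (a, b; b^T, D) restricts to its Schur complement. *)
Lemma schur_row (R : fieldType) (k n : nat) (a : R) (b : 'rV[R]_n)
    (D : 'M[R]_n) (Y : 'M[R]_(k, n)) : a != 0 ->
  row_mx (- a^-1 *: (Y *m b^T)) Y *m block_mx a%:M b b^T D =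
  row_mx 0 (Y *m (D - a^-1 *: (b^T *m b))).
Proof.
move=> a0; rewrite mul_row_block mul_mx_scalar scalerA mulrN mulfV//.
rewrite scaleN1r addNr mulmxBr -scalemxAr -scalemxAl mulmxA scaleNr.
by rewrite [X in row_mx _ X]addrC.
Qed.

(** Gram-Schmidt, by induction on the dimension: normalize the first basis vector
    and apply the induction hypothesis to the Schur complement. *)
Lemma orthonormal_exists (R : rcfType) (n : nat) (G : 'M[R]_n) :
  G^T = G -> (forall v : 'rV[R]_n, v != 0 -> 0 < (v *m G *m v^T) 0 0) ->
  exists e : 'M[R]_n, e *m G *m e^T = 1%:M.
Proof.
elim: n => [|n IHn] in G *.
  by move=> _ _; exists 0; apply/matrixP => -[].
change 'M[R]_(1 + n) in G => Gsym Gpos.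
pose b := ursubmx G; pose D := drsubmx G.
have [a GE] : exists a, G = block_mx a%:M b b^T D.
  exists (ulsubmx G 0 0).
  by rewrite -mx11_scalar /b trmx_ursub Gsym submxK.
have Dsym : D^T = D by rewrite /D trmx_drsub Gsym.
clearbody b D; subst G.
have {}Gpos (v : 'rV[R]_(1 + n)) : v != 0 ->
  0 < (v *m block_mx a%:M b b^T D *m v^T) 0 0 by exact: Gpos.
clear Gsym; have a0 : 0 < a.
  have := Gpos (row_mx 1%:M 0).
  rewrite mul_row_block tr_row_mx mul_row_col trmx0 mulmx0 addr0 mul0mx addr0.
  rewrite mul1mx trmx1 mulmx1 mxE mulr1n; apply.
  apply/eqP => /matrixP/(_ 0 (lshift n 0)).
  by rewrite row_mxEl !mxE => /eqP; rewrite oner_eq0.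
have an0 := lt0r_neq0 a0.
have [||e' e'S] := IHn (D - a^-1 *: (b^T *m b)).
- by rewrite linearB linearZ /= trmx_mul trmxK Dsym.
- move=> v v0; have := Gpos (row_mx (- a^-1 *: (v *m b^T)) v).
  rewrite schur_row// tr_row_mx mul_row_col mul0mx add0r; apply.
  apply: contraNneq v0 => /eqP; rewrite row_mx_eq0 => /andP[_ /eqP->].
  by rewrite eqxx.
pose c := (Num.sqrt a)^-1.
have cac : c * a * c = 1.
  rewrite /c -{2}(sqr_sqrtr (ltW a0)) expr2 mulKf ?mulfV//;
  by rewrite sqrtr_eq0 -ltNge.
suff: exists e : 'M[R]_(1 + n), e *m block_mx a%:M b b^T D *m e^T = 1%:M by [].
exists (col_mx (row_mx c%:M 0) (row_mx (- a^-1 *: (e' *m b^T)) e')).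
rewrite mul_col_mx schur_row// tr_col_mx mul_col_row !tr_row_mx.
rewrite mul_row_block !mul_row_col.
rewrite !(mul0mx, mulmx0, add0r, addr0) e'S.
rewrite !mul_scalar_mx tr_scalar_mx trmx0 mulmx0 mul_mx_scalar.
have -> : (- a^-1 *: (e' *m b^T))^T = - a^-1 *: (b *m e'^T).
  by rewrite [LHS]linearZ /= trmx_mul trmxK.
rewrite -!scalemxAl mul_scalar_mx !scalerA mulrN mulfK// scaleNr addNr.
rewrite addr0 mulmx0 scale_scalar_mx mulrAC cac.
by rewrite -scalar_mx_block.
Qed.

Lemma sum_pairs_half (R : numFieldType) (n : nat) (F : 'I_n -> 'I_n -> R) :
  (forall j k, F j k = F k j) -> (forall j, F j j = 0) ->
  \sum_(j < n) \sum_(k < n | (j < k)%N) F j k =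
  2^-1 * \sum_(j < n) \sum_(k < n) F j k.
Proof.
move=> Fsym F0.
have -> : \sum_(j < n) \sum_(k < n) F j k =
    \sum_(j < n) \sum_(k < n | (j < k)%N) F j k +
    \sum_(j < n) \sum_(k < n | (k < j)%N) F j k.
  rewrite -big_split; apply: eq_bigr => j _ /=.
  rewrite (bigID (fun k : 'I_n => (j < k)%N)) /=; congr (_ + _).
  rewrite (bigD1 j) ?ltnn//= F0 add0r; apply: eq_bigl => k.
  by rewrite -leqNgt ltn_neqAle andbC.
have -> : \sum_(j < n) \sum_(k < n | (k < j)%N) F j k =
    \sum_(j < n) \sum_(k < n | (j < k)%N) F j k.
  rewrite (exchange_big_dep predT)//=; apply: eq_bigr => k _.
  by apply: eq_bigr => j _.
by field.
Qed.

Section hom_inner.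
Context (R : realType) (r : nat) (H : 'M[R]_r).

Lemma hom_inner_suml (I : finType) (x : I -> R) (S : I -> 'M[R]_r) U :
  hom_inner H (\sum_i x i *: S i) U = \sum_i x i * hom_inner H (S i) U.
Proof.
rewrite /hom_inner linear_sum mulmx_sumr !mulmx_suml linear_sum.
apply: eq_bigr => i _ /=.
by rewrite linearZ /= -scalemxAr -!scalemxAl linearZ.
Qed.

Lemma hom_inner_sumr (I : finType) (x : I -> R) S (U : I -> 'M[R]_r) :
  hom_inner H S (\sum_i x i *: U i) = \sum_i x i * hom_inner H S (U i).
Proof.
rewrite /hom_inner mulmx_sumr linear_sum.
by apply: eq_bigr => i _; rewrite -scalemxAr linearZ.
Qed.

End hom_inner.

(** This product does not depend on e, which is why contractions over an
    orthonormal basis do not depend on the basis. *)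
Lemma tr_orthonormal_mul (R : realFieldType) (n : nat) (G e : 'M[R]_n) :
  e *m G *m e^T = 1%:M -> e^T *m e = invmx G.
Proof.
rewrite -mulmxA => /mulmx1C; rewrite -mulmxA => GE.
have [+ _] := mulmx1_unit GE; move/mulKmx => GK.
by rewrite -[LHS]GK GE mulmx1.
Qed.

(** The squared norm of a 2-form computed in an orthonormal basis is the full
    contraction of its coefficients with the inverse Gram matrix: by antisymmetry
    the sum over j < k is half of the sum over all pairs, and the latter depends
    on e only through e^T e. *)
Lemma orthonormal_sqnormE (R : realType) (n r : nat) (G e : 'M[R]_n)
    (H : 'M[R]_r) (C : 'I_n -> 'I_n -> 'M[R]_r)
    (K := fun v w : 'rV[R]_n => \sum_k \sum_l (v 0 k * w 0 l) *: C k l) :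
  e *m G *m e^T = 1%:M -> (forall k l, C k l = - C l k) ->
  \sum_(j < n) \sum_(k < n | (j < k)%N)
    hom_inner H (K (row j e) (row k e)) (K (row j e) (row k e)) =
  2^-1 * \sum_(s : 'I_n * 'I_n) \sum_(t : 'I_n * 'I_n)
    invmx G s.1 t.1 * invmx G s.2 t.2 * hom_inner H (C s.1 s.2) (C t.1 t.2).
Proof.
move=> eG Canti.
have Kanti v w : K v w = - K w v.
  rewrite /K exchange_big -sumrN; apply: eq_bigr => k _.
  rewrite -sumrN; apply: eq_bigr => l _.
  by rewrite Canti scalerN mulrC.
have KE v w : K v w = \sum_(s : 'I_n * 'I_n) (v 0 s.1 * w 0 s.2) *: C s.1 s.2.
  by rewrite /K pair_bigA.
have innerNN S : hom_inner H (- S) (- S) = hom_inner H S S.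
  by rewrite /hom_inner [(- S)^T]linearN /= !(mulmxN, mulNmx) opprK.
rewrite sum_pairs_half; last 2 first.
- by move=> j k; rewrite [in LHS]Kanti innerNN.
- move=> j; have /eqP := Kanti (row j e) (row j e).
  rewrite -addr_eq0 -mulr2n -scaler_nat scaler_eq0 pnatr_eq0/= => /eqP->.
  by rewrite /hom_inner mulmx0 linear0.
congr (_ * _); rewrite pair_bigA /=.
under eq_bigr => jk _.
  rewrite KE hom_inner_suml; under eq_bigr do rewrite hom_inner_sumr mulr_sumr.
  over.
rewrite exchange_big; apply: eq_bigr => s _.
rewrite exchange_big; apply: eq_bigr => t _ /=.
rewrite -(tr_orthonormal_mul eG) !mxE big_distrlr /= pair_bigA mulr_suml.
by apply: eq_bigr => jk _ /=; rewrite !mxE; ring.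
Qed.

Lemma posdef_unitmx (R : rcfType) (n : nat) (G : 'M[R]_n) :
  G^T = G -> (forall v : 'rV[R]_n, v != 0 -> 0 < (v *m G *m v^T) 0 0) ->
  G \in unitmx.
Proof.
move=> Gsym Gpos; have [e /mulmx1_unit[]] := orthonormal_exists Gsym Gpos.
by rewrite unitmx_mul => /andP[].
Qed.

(** * Borel measurability in charts *)

Section continuous_on_open.
Context (R : realType) (M : ptopologicalType).

Lemma measurable_open (U : set M) : open U -> measurable (U : set (borel M)).
Proof. exact: sub_sigma_algebra. Qed.

Lemma open_setI_preimage (N : topologicalType) (U : set M) (f : M -> N)
    (V : set N) : open U -> (forall x, U x -> {for x, continuous f}) -> open V ->
  open (U `&` f @^-1` V).
Proof.
move=> oU cf oV; rewrite openE => x [Ux Vfx]; apply: filterI.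
  exact: open_nbhs_nbhs.
by apply: cf => //; exact: open_nbhs_nbhs.
Qed.

Lemma continuous_measurable_on (U : set M) (f : M -> R) :
  open U -> (forall x, U x -> {for x, continuous f}) ->
  measurable_fun (U : set (borel M)) (f : borel M -> R).
Proof.
move=> oU cf; apply: (measurability _ (RGenOInfty.measurableE R)).
move=> _ [_ [y ->] <-]; apply: measurable_open.
by apply: open_setI_preimage => //; exact: open_itvoy.
Qed.

End continuous_on_open.

Section charts.
Context (R : realType) (n : nat) (M : ptopologicalType) (X : manifold R n M).

Lemma open_image_coord (i : nat) (U : set M) : open U -> U `<=` dom X i ->
  open (coord X i @` U).
Proof.
move=> oU Ui; rewrite openE => _ [x Ux <-].
have dx := Ui _ Ux.
have : nbhs (coord X i x) (coord X i @` dom X i `&` point_at X i @^-1` U).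
  apply: filterI.
    by apply: open_nbhs_nbhs; split; [exact: coord_open|exists x].
  apply: point_at_continuous; first by exists x.
  by rewrite coordK//; exact: open_nbhs_nbhs.
apply: filterS => _ [[z dz <-]] /=; rewrite coordK// => Uz.
by exists z.
Qed.

Definition coord_tuple (i : nat) (x : borel M) : n.-tuple (measurableTypeR R) :=
  [tuple coord X i x 0 j | j < n].

Lemma coord_tupleK i x : row_of_tuple (coord_tuple i x) = coord X i x.
Proof. by apply/rowP => j; rewrite !mxE tnth_mktuple. Qed.

Lemma measurable_coord_tuple (i : nat) (U : set (borel M)) :
  open (U : set M) -> U `<=` dom X i -> measurable_fun U (coord_tuple i).
Proof.
move=> oU Ui; have mU : measurable U by exact: measurable_open.
apply/(measurable_restrictT _ mU)/measurable_fun_tnthP => j.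
rewrite (_ : _ \o _ = (fun x : borel M => coord X i x 0 j) \_ U); last first.
  apply/funext => x /=; rewrite /patch; case: ifPn => // _.
    by rewrite tnth_mktuple.
  (* Off U both sides are default values: the default tuple is constant. *)
  by rewrite [LHS]tnth_nseq.
apply/(measurable_restrictT _ mU); apply: (@continuous_measurable_on R M U) => // x Ux.
apply: (@continuous_comp _ _ _ (coord X i) (fun y : 'rV[R]_n => y 0 j)).
  exact/coord_continuous/Ui.
exact: matrix_normedtype.coord_continuous.
Qed.


(** Transports measurability in the coordinates of a chart, where the coefficients
    of a connection are given, to the manifold. *)
Lemma measurable_comp_coord (i : nat) (U : set (borel M)) (O : set 'rV[R]_n)
    (phi : 'rV[R]_n -> R) :
  open (U : set M) -> U `<=` dom X i -> open O -> coord X i @` U `<=` O ->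
  measurable_fun (tuples_of O) (phi \o @row_of_tuple R n) ->
  measurable_fun U (phi \o coord X i).
Proof.
move=> oU Ui oO UO mphi.
have -> : phi \o coord X i = (phi \o @row_of_tuple R n) \o coord_tuple i.
  by apply/funext => x /=; rewrite coord_tupleK.
apply: (measurable_comp (measurable_tuples_of oO) _ mphi).
  by move=> _ [x Ux <-]; rewrite /tuples_of/= coord_tupleK; apply: UO; exists x.
exact: measurable_coord_tuple.
Qed.

End charts.

(** * The norm of the curvature is Borel measurable *)

(** The first member of a countable open cover around a point is a Borel function
    of the point: the set in question is one open set minus those before it. *)
Lemma measurable_ex_minn (M : ptopologicalType) (P : nat -> set M)
    (cov : forall x, exists i, `[< P i x >]) (i : nat) :
  (forall j, open (P j)) -> measurable ([set x | ex_minn (cov x) = i] : set (borel M)).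
Proof.
move=> oP; rewrite (_ : mkset _ = P i `\` \bigcup_(j in `I_i) P j).
  apply: measurableD; first exact: measurable_open.
  by apply: bigcup_measurable => j _; exact: measurable_open.
apply/seteqP; split=> x /=.
  move=> <-; case: ex_minnP => j /asboolP Pj minj; split=> // -[k /= kj Pk].
  by have := minj _ (asboolT Pk); rewrite leqNgt kj.
move=> [Pi nP]; case: ex_minnP => j /asboolP Pj minj.
apply/eqP; rewrite eqn_leq minj ?asboolT//= leqNgt.
by apply/negP => ji; apply: nP; exists j.
Qed.

Lemma measurable_wpartial (R : realType) (n : nat) (O : set 'rV[R]_n) (k : 'I_n) f :
  measurable_fun (tuples_of O) (wpartial O k f \o @row_of_tuple R n).
Proof.
rewrite /wpartial; case: xgetP => [D _ [[mD _] _]//|_].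
exact: measurable_cst.
Qed.

Section curvature_measurable.
Context (R : realType) (n : nat) (M : ptopologicalType) (X : manifold R n M).
Context (g : riemannian_metric X) (r : nat) (E : vector_bundle X r).
Context (h : fiber_metric E) (A : connection E).

Lemma inner0l x w : inner h (0 : fiber E x) w = 0.
Proof.
have := inner_linear h 1 (0 : fiber E x) 0 w.
by rewrite scaler0 addr0 mul1r => /esym/eqP; rewrite -subr_eq0 addrK => /eqP.
Qed.

Lemma inner_suml x (I : finType) (c : I -> R) (u : I -> fiber E x) w :
  inner h (\sum_i c i *: u i) w = \sum_i c i * inner h (u i) w.
Proof.
elim/big_rec2 : _ => [|i y1 y2 _ <-]; first exact: inner0l.
by rewrite inner_linear.
Qed.

Lemma inner_sumr x (I : finType) (c : I -> R) (u : I -> fiber E x) w :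
  inner h w (\sum_i c i *: u i) = \sum_i c i * inner h w (u i).
Proof.
by rewrite inner_sym inner_suml; apply: eq_bigr => i _; rewrite inner_sym.
Qed.

(** The Gram matrix of a frame is positive definite: a nonzero coefficient vector
    v gives the vector u = sum_s v_s e_s, which is nonzero because the
    trivialization maps it back to v. *)
Lemma fiber_gram_unitmx a x : vdom E a x -> fiber_gram h a x \in unitmx.
Proof.
move=> ax; apply: posdef_unitmx => [|v v0].
  by apply/matrixP => s t; rewrite !mxE inner_sym.
pose u := \sum_s v 0 s *: frame E a x (delta_mx s 0).
have u0 : u != 0.
  apply: contraNneq v0 => u0; rewrite -[v]trmxK -(linear0 (@trmx R r 1)).
  apply/eqP; congr trmx; rewrite -[RHS](linear0 (triv E a x)) -u0 linear_sum /=.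
  apply/colP => s; rewrite mxE summxE (bigD1 s)//= big1 ?addr0.
    by rewrite linearZ /= frameK// !mxE !eqxx mulr1.
  by move=> t ts; rewrite linearZ /= frameK// !mxE eq_sym (negPf ts) mulr0.
have := inner_gt0 h u0; rewrite {1}/u inner_suml.
congr (0 < _); rewrite !mxE.
under [RHS]eq_bigr => t _ do rewrite !mxE mulr_suml.
rewrite exchange_big /=; apply: eq_bigr => s _.
rewrite /u inner_sumr mulr_sumr; apply: eq_bigr => t _.
by rewrite !mxE; ring.
Qed.

Lemma gram_unitmx i y : (coord X i @` dom X i) y -> gram g i y \in unitmx.
Proof. by move=> iy; apply: posdef_unitmx => [|v]; [exact: gram_sym|exact: gram_gt0]. Qed.

Let overlap i a : set (borel M) := dom X i `&` vdom E a.

Let open_overlap i a : open (overlap i a : set M).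
Proof. by apply: openI; [exact: dom_open|exact: vdom_open]. Qed.

Let overlap_dom i a : overlap i a `<=` dom X i.
Proof. exact: subIsetl. Qed.

Lemma measurable_curvature_coef i a k l :
  measurable_mx (overlap i a) (fun x => curvature_coef A i a k l (coord X i x)).
Proof.
have oU := @open_overlap i a; have Ui := @overlap_dom i a.
have oO : open (region E i a) by exact: open_image_coord.
have mform k' : measurable_mx (overlap i a) (fun x => form A i a k' (coord X i x)).
  move=> s t.
  apply: (@measurable_comp_coord _ _ _ X i (overlap i a) (region E i a)
            (fun y => form A i a k' y s t)) => //.
  exact: form_measurable.
have mpartial k' l' s t : measurable_fun (overlap i a) (fun x : borel M =>
    wpartial (region E i a) k' (fun z => form A i a l' z s t) (coord X i x)).
  apply: (@measurable_comp_coord _ _ _ X i (overlap i a) (region E i a)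
    (wpartial (region E i a) k' (fun z => form A i a l' z s t))) => //.
  exact: measurable_wpartial.
apply: measurable_mxD.
  by move=> s t; under eq_fun do rewrite mxE; exact: measurable_funB.
apply: measurable_mxD; last apply: measurable_mxN; exact: measurable_mx_mul.
Qed.

Lemma measurable_gram i :
  measurable_mx (dom X i : set (borel M)) (fun x => gram g i (coord X i x)).
Proof.
move=> k l; apply: (@continuous_measurable_on R M (dom X i)); first exact: dom_open.
move=> x ix; apply: (@continuous_comp _ _ _ (coord X i) (fun y => gram g i y k l)).
  exact: coord_continuous.
by apply: (gram_smooth g i k l 0).1; exists x.
Qed.

Lemma measurable_fiber_gram i a : measurable_mx (overlap i a) (fiber_gram h a).
Proof.
have oU := @open_overlap i a.
move=> s t; pose F y := inner h (frame E a (point_at X i y) (delta_mx s 0))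
                        (frame E a (point_at X i y) (delta_mx t 0)).
apply: (@eq_measurable_fun _ _ (borel M) R _ (F \o coord X i)).
  by move=> x /set_mem[ix _]; rewrite /F /= mxE coordK.
apply: (@continuous_measurable_on R M (overlap i a)) => // x ax.
apply: (@continuous_comp _ _ _ (coord X i) F).
  exact/coord_continuous/(@overlap_dom i a).
by apply: (inner_smooth h i a s t 0).1; exists x.
Qed.

(** The squared norm of the curvature in the chart i and the trivialization a,
    without a choice of orthonormal basis. Unlike that choice, which need not be
    measurable in x, the inverse metric is. *)
Definition local_sqnorm (i a : nat) (x : borel M) : R :=
  2^-1 * \sum_(s : 'I_n * 'I_n) \sum_(t : 'I_n * 'I_n)
    invmx (gram g i (coord X i x)) s.1 t.1 * invmx (gram g i (coord X i x)) s.2 t.2 *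
    hom_inner (fiber_gram h a x) (curvature_coef A i a s.1 s.2 (coord X i x))
                                 (curvature_coef A i a t.1 t.2 (coord X i x)).

Lemma measurable_local_sqnorm i a : measurable_fun (overlap i a) (local_sqnorm i a).
Proof.
have oU := @open_overlap i a.
have mU : measurable (overlap i a) by exact: measurable_open.
apply: measurable_funM => //; apply: measurable_sum => s; apply: measurable_sum => t.
have minv : measurable_mx (overlap i a) (fun x => invmx (gram g i (coord X i x))).
  apply: measurable_mx_inv => [x [ix _]|k l]; first by apply: gram_unitmx; exists x.
  have mD : measurable (dom X i : set (borel M)) by apply: measurable_open; exact: dom_open.
  exact: (measurable_funS mD (@overlap_dom i a) (@measurable_gram i k l)).
apply: measurable_funM; first by apply: measurable_funM; exact: minv.
apply: measurable_hom_inner => [x [_ ax]|||]; first exact: fiber_gram_unitmx.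
- exact: measurable_fiber_gram.
- exact: measurable_curvature_coef.
- exact: measurable_curvature_coef.
Qed.

Lemma curvature_sqnormE x :
  curvature_sqnorm g h A x = local_sqnorm (chart_at X x) (triv_at E x) x.
Proof.
have ix : dom X (chart_at X x) x.
  by rewrite /chart_at; case: ex_minnP => i /asboolP.
rewrite /curvature_sqnorm /local_sqnorm; set i := chart_at X x in ix *.
set y := coord X i x; set G := gram g i y.
apply: orthonormal_sqnormE.
  rewrite -/(orthonormal G (onbasis G)) /onbasis; apply: xgetPex.
  apply: orthonormal_exists => [|v]; first by apply: gram_sym; exists x.
  by apply: gram_gt0; exists x.
move=> k l; rewrite /curvature_coef opprD opprB; congr (_ + _).
by apply/matrixP => s t; rewrite !mxE opprB.
Qed.

(** On the Borel set where the chosen chart is the i-th one and the chosen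
    trivialization the a-th one, the squared norm is the measurable function
    local_sqnorm i a; countably many such sets cover the manifold. *)
Lemma measurable_curvature_norm :
  measurable_fun [set: borel M] (curvature_norm g h A : borel M -> R).
Proof.
suff mF : measurable_fun [set: borel M] (curvature_sqnorm g h A : borel M -> R).
  (* The maximum with 0 makes the power agree with the square root at negative
     arguments, where sqrt is 0 and the power would be 1. *)
  rewrite (_ : curvature_norm g h A = (fun x => Num.max 0 (curvature_sqnorm g h A x) `^ 2^-1)).
    apply: (measurableT_comp (f := (@powR R ^~ 2^-1))); first exact: measurable_powR.
    by apply: measurable_maxr.
  apply/funext => x; rewrite /curvature_norm powR12_sqrt ?le_max ?lexx//.
  by case: leP => // /ltW /ler0_sqrtr ->; rewrite sqrtr0.
move=> _ Y mY; rewrite setTI.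
pose piece (p : nat * nat) : set (borel M) :=
  [set x | chart_at X x = p.1] `&` [set x | triv_at E x = p.2].
rewrite (_ : _ @^-1` Y = \bigcup_p (piece p `&` local_sqnorm p.1 p.2 @^-1` Y)); last first.
  apply/seteqP; split=> x /=; rewrite /preimage/= curvature_sqnormE.
    by move=> Yx; exists (chart_at X x, triv_at E x).
  by case=> -[i a] _ [[/= -> ->]].
apply: countable_bigcupT_measurable => [|p]; first exact: countableP.
have mpiece : measurable (piece p).
  by apply: measurableI; apply: measurable_ex_minn => j; [exact: dom_open|exact: vdom_open].
have piece_overlap : piece p `<=` overlap p.1 p.2.
  move=> x [<- <-]; rewrite /chart_at /triv_at; split.
    by case: ex_minnP => i /asboolP.
  by case: ex_minnP => i /asboolP.
have mU : measurable (overlap p.1 p.2) by exact: measurable_open.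
exact: (measurable_funS mU piece_overlap (@measurable_local_sqnorm p.1 p.2)).
Qed.

End curvature_measurable.

(** * A compact Riemannian manifold has finite volume *)

(** Integrals of nonnegative functions are suprema over the simple functions below
    them, hence monotone even without measurability. *)
Lemma le_integralT d (T : measurableType d) (R : realType)
    (mu : {measure set T -> \bar R}) (f k : T -> \bar R) :
  (forall x, 0 <= f x)%E -> (forall x, f x <= k x)%E ->
  (\int[mu]_x f x <= \int[mu]_x k x)%E.
Proof.
move=> f0 fk; rewrite !ge0_integralTE//; last first.
  by move=> x; exact: le_trans (fk x).
apply: ereal_sup_le => _ [s sf <-]; exists s => // x.
exact: le_trans (fk x).
Qed.

Lemma lebesgue_tuple_ball_lty (R : realType) (n : nat) (y : 'rV[R]_n) (e : R) :
  0 < e -> (lebesgue_tuple R n (tuples_of (ball y e)) < +oo)%E.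
Proof.
move=> e0; elim: n => [|n IHn] in y *.
  by rewrite /= diracE ltry.
pose y' := \row_j y 0 (lift ord0 j).
rewrite /= /lebesgue_step /pushforward.
have -> : (fun z : measurableTypeR R * n.-tuple (measurableTypeR R) =>
    [tuple of z.1 :: z.2]) @^-1` tuples_of (ball y e) =
    ball (y 0 ord0) e `*` tuples_of (ball y' e).
  apply/seteqP; split=> [[a t]|[a t] [/= a0 /(row_ballE _ _ e0) ty]].
    move=> /(row_ballE _ _ e0) H; split.
      by have := H ord0; rewrite mxE.
    by apply/row_ballE => // j; have := H (lift ord0 j); rewrite !mxE tnthS.
  apply/row_ballE => // j; rewrite mxE; have [j0 ->|->//] := unliftP ord0 j.
  by rewrite tnthS; have := ty j0; rewrite !mxE.
rewrite product_measure1E; last 2 first.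
- exact: measurable_ball.
- exact: measurable_tuples_of_ball.
rewrite lte_mul_pinfty ?measure_ge0//.
by rewrite [X in X \is a fin_num](lebesgue_measure_ball (y 0 ord0) (ltW e0)).
Qed.

Lemma cvg_det (R : realType) (n : nat) (V : topologicalType) (y : V) (G : V -> 'M[R]_n) :
  (forall k l, {for y, continuous (fun z => G z k l)}) ->
  {for y, continuous (fun z => \det (G z))}.
Proof.
move=> cG; rewrite /prop_for /continuous_at /determinant.
apply: cvg_big => [|s _]; first exact: add_continuous.
apply: cvgM; first exact: cvg_cst.
by apply: cvg_big => [|i _]; [exact: mul_continuous|exact: cG].
Qed.

Section finite_volume.
Context (R : realType) (n : nat) (M : ptopologicalType) (X : manifold R n M).
Context (g : riemannian_metric X) (vol : {measure set (borel M) -> \bar R}).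
Hypothesis hvol : riemannian_volume g vol.

(** In a chart, the volume density is bounded near a point by continuity, and
    balls have finite Lebesgue measure. *)
Lemma locally_finite_volume (x : M) :
  exists U : set M, [/\ open U, U x & (vol U < +oo)%E].
Proof.
have [i /asboolP ix] := cover X x.
pose f y := Num.sqrt (\det (gram g i y)).
have cf : {for coord X i x, continuous f}.
  apply: (@continuous_comp _ _ _ (fun y => \det (gram g i y)) Num.sqrt).
    by apply: cvg_det => k l; apply: (gram_smooth g i k l 0).1; exists x.
  exact: sqrt_continuous.
set y := coord X i x; set C := f y + 1.
pose W := ball y 1 `&` [set z | f z < C].
have Wy : nbhs y W.
  apply: filterI; first exact: nbhsx_ballx.
  have : nbhs (f y) [set z | z < C].
    by apply: open_nbhs_nbhs; split; [exact: open_lt|rewrite /= ltrDl].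
  by move=> /cf.
pose U := dom X i `&` coord X i @^-1` W°.
have oU : open U.
  apply: open_setI_preimage; [exact: dom_open|exact: coord_continuous|].
  exact: open_interior.
exists U; split => //.
rewrite (hvol (measurable_open oU) (@subIsetl _ _ _)) integral_mkcond.
set B := tuples_of (ball y 1).
have mB : measurable B by exact: measurable_tuples_of_ball.
have C0 : 0 <= C by rewrite addr_ge0// sqrtr_ge0.
apply: (@le_lt_trans _ _ (\int[lebesgue_tuple R n]_(t in B) C%:E)%E); last first.
  rewrite (@integral_cst _ _ _ _ _ mB C%:E).
  by rewrite lte_mul_pinfty ?lee_fin// lebesgue_tuple_ball_lty.
rewrite [leRHS]integral_mkcond; apply: le_integralT => t.
  by rewrite /patch; case: ifP => // _; rewrite lee_fin sqrtr_ge0.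
rewrite /patch; case: ifPn => [/set_mem[z [_ Wz] zt]|_]; last first.
  by case: ifP => // _; rewrite lee_fin.
have [Bt fC] : W (row_of_tuple t) by rewrite -zt; exact: interior_subset.
by rewrite mem_set// lee_fin ltW.
Qed.

Lemma finite_volume : compact [set: M] -> (vol [set: M] < +oo)%E.
Proof.
rewrite compact_cover => compM.
have /choice[U HU] := locally_finite_volume.
have [| |D _ DT] := compM M setT U.
- by move=> x _; have [] := HU x.
- by move=> x _; exists x => //; have [] := HU x.
move: DT; rewrite /classical_sets.cover bigcup_fset.
set S := \big[_/_]_(_ <- _) _ => TS.
have -> : [set: M] = S by apply/seteqP; split.
suff [] : measurable (S : set (borel M)) /\ (vol S < +oo)%E by [].
rewrite {TS}/S.
elim/big_ind : _ => [|P Q [mP vP] [mQ vQ]|x _].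
- by split; [exact: measurable0|rewrite measure0 ltry].
- split; first exact: measurableU.
  by rewrite (le_lt_trans (measureU2 _ mP mQ))// lte_add_pinfty.
- by have [oU _ vU] := HU x; split => //; exact: measurable_open.
Qed.

End finite_volume.

Unset Implicit Arguments.

(** * Yang-Mills and p-Yang-Mills energies *)

Theorem theorem10p1 (R : realType) (n : nat) (M : ptopologicalType)
    (hausM : hausdorff_space M) (compM : compact [set: M])
    (X : manifold R n M) (g : riemannian_metric X)
    (vol : {measure set (borel M) -> \bar R}) (hvol : riemannian_volume g vol)
    (r : nat) (E : vector_bundle X r) (h : fiber_metric E)
    (p : R) (hp : 2 <= p) (A : connection E) (hA : Wp p A) :
  let Vol := vol [set: M] in
  let lhs := ((p^-1)%:E * (2%:E / Vol * YM g h vol A) `^ (p / 2))%E in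
  let rhs := (Vol^-1 * YMp p g h vol A)%E in
  let constant_ae :=
    exists c : R, {ae vol, forall x, curvature_norm g h A x = c} in
  [/\ (lhs <= rhs)%E,
      constant_ae -> lhs = rhs &
      2 < p -> (YMp p g h vol A < +oo)%E -> lhs = rhs -> constant_ae].
Proof.
apply: power_mean_le => //.
- exact: finite_volume hvol compM.
- exact: measurable_curvature_norm.
- by move=> x; exact: sqrtr_ge0.
Qed.
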